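(* For $n\in\{3,4,5\}$ and every $\mathfrak{e}\in[0,1)$, the regular $n$-gon elliptic relative equilibrium of eccentricity $\mathfrak{e}$ is hyperbolic, i.e. the monodromy matrix $\eta_{\mathfrak{e}}(2\pi)$ of its essential part has no eigenvalue on the unit circle.
   Context: The regular $n$-gon elliptic relative equilibrium (ERE) of eccentricity $\mathfrak{e}\in[0,1)$ is the homographic Kepler solution of the planar Newtonian $n$-body problem in which $n$ unit masses stay at the vertices of a regular $n$-gon, each moving on a Kepler ellipse of eccentricity $\mathfrak{e}$. In suitable symplectic coordinates, with the true anomaly $\theta\in[0,2\pi]$ as independent variable, its linearized Hamiltonian system splits as a symplectic direct sum of a translation part, a dilation/rotation (Kepler) part, and an essential part $\eta_{\mathfrak{e}}'=JB_3(\theta)\eta_{\mathfrak{e}}$, $\eta_{\mathfrak{e}}(0)=I$, of dimension $4n-8$, where $B_3=\mathcal{B}_1\diamond\cdots\diamond\mathcal{B}_{[n/2]}$, $$\mathcal{B}_l(\theta)=\begin{pmatrix}I&-\mathbb{J}\\ \mathbb{J}&I-\frac{I+\mathcal{U}_l}{1+\mathfrak{e}\cos\theta}\end{pmatrix}.$$ Here $J=J_{2j}=\begin{pmatrix}0_j&-I_j\\ I_j&0_j\end{pmatrix}$, $\mathbb{J}=\mathrm{diag}(J_2,\dots,J_2)$, with $I,\mathbb{J}$ of the size of $\mathcal{U}_l$; $[x]$ is the integer part; and for $M_1=\begin{pmatrix} A_1 & A_2 \\ A_3 & A_4 \end{pmatrix}$, $M_2=\begin{pmatrix} B_1 & B_2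 \\ B_3 & B_4 \end{pmatrix}$, $M_1\diamond M_2=\begin{pmatrix} A_1 & 0 & A_2 & 0 \\ 0 & B_1 & 0 & B_2 \\ A_3 & 0 & A_4 & 0 \\ 0 & B_3 & 0 & B_4 \end{pmatrix}$. With $\theta_j=2\pi j/n$, $\theta_{jl}=2\pi jl/n$, $d_{nj}=2\sin\frac{\pi j}n$, $\lambda=\frac14\sum_{j=1}^{n-1}\csc\frac{\pi j}n$: $$\mathcal{U}_1=\frac z\lambda I_2,\quad z=\sum_{j=1}^{n-1}\frac{1-\cos2\theta_j}{2d_{nj}^3},\qquad \mathcal{U}_l=\frac1\lambda\begin{pmatrix} a_l & 0 & 0 & S_l \\ 0 & b_l & -S_l & 0 \\ 0 & -S_l & a_l & 0 \\ S_l & 0 & 0 & b_l \end{pmatrix}\ (2\le l\le[\tfrac{n-1}2]),\quad \mathcal{U}_{n/2}=\frac1\lambda\,\mathrm{diag}(a_{n/2},b_{n/2})\ (n\text{ even}),$$ $a_l=P_l-3Q_l$, $b_l=P_l+3Q_l$, $P_l=\sum_{j=1}^{n-1}\frac{1-\cos\theta_{jl}\cos\theta_j}{2d_{nj}^3}$, $S_l=\sum_{j=1}^{n-1}\frac{\sin\theta_{jl}\sin\theta_j}{2d_{nj}^3}$, $Q_l=\sum_{j=1}^{n-1}\frac{\cos\theta_j-\cos\theta_{jl}}{2d_{nj}^3}$. (Thus $B_3=\mathcal{B}_1$ for $n=3$ and $B_3=\mathcal{B}_1\diamond\mathcal{B}_2$ for $n=4,5$.) The ERE is called hyperbolic if $\eta_{\mathfrak{e}}(2\pi)$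 has no eigenvalue on the unit circle of $\mathbb{C}$. *)

(* Defs.v *)
From HB Require Import structures.
From mathcomp Require Import all_boot all_order all_algebra.
From mathcomp Require Import all_classical all_reals all_analysis.
From mathcomp Require Import complex.

Set Implicit Arguments.
Unset Strict Implicit.
Unset Printing Implicit Defensive.

Import Order.TTheory GRing.Theory Num.Theory.
Import numFieldNormedType.Exports.

Local Open Scope classical_set_scope.
Local Open Scope ring_scope.

Section Symplectic.
Context {R : realType}.

Definition Jmx m : 'M[R]_(m + m) := block_mx 0 (- 1%:M) 1%:M 0.

(* For m even this is diag(J_2, ..., J_2), with J_2 = (0 -1; 1 0). *)
Definition Jdiag m : 'M[R]_m :=
  \matrix_(i, j) (if odd i && (i == j.+1 :> nat) then 1
                  else if odd j && (j == i.+1 :> nat) then -1 else 0).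

(* The symplectic direct sum M1 <> M2. *)
Definition diamond m k (M1 : 'M[R]_(m + m)) (M2 : 'M[R]_(k + k)) :
    'M[R]_((m + k) + (m + k)) :=
  block_mx (block_mx (ulsubmx M1) 0 0 (ulsubmx M2))
           (block_mx (ursubmx M1) 0 0 (ursubmx M2))
           (block_mx (dlsubmx M1) 0 0 (dlsubmx M2))
           (block_mx (drsubmx M1) 0 0 (drsubmx M2)).

Definition fundamental_solution m (B : R -> 'M[R]_(m + m))
    (eta : R -> 'M[R]_(m + m)) : Prop :=
  [/\ eta 0 = 1%:M,
      {within `[0, 2 * pi], continuous eta} &
      forall theta, theta \in `]0, 2 * pi[ ->
        is_derive theta 1 eta (Jmx m *m B theta *m eta theta)].

Definition no_unit_circle_eigenvalue m (M : 'M[R]_m) : Prop :=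
  forall w : R[i], `|w| = 1 -> ~~ eigenvalue (map_mx (real_complex R) M) w.

End Symplectic.

Section RegularPolygon.
Context {R : realType}.
Variable n : nat.

Definition ang (j : nat) : R := 2 * pi * j%:R / n%:R.
Definition dist (j : nat) : R := 2 * sin (pi * j%:R / n%:R).

Definition lam : R := 4^-1 * \sum_(1 <= j < n) (sin (pi * j%:R / n%:R))^-1.

Definition zcoef : R :=
  \sum_(1 <= j < n) (1 - cos (2 * ang j)) / (2 * dist j ^+ 3).

Definition Pcoef (l : nat) : R :=
  \sum_(1 <= j < n) (1 - cos (ang (j * l)%N) * cos (ang j)) / (2 * dist j ^+ 3).
Definition Scoef (l : nat) : R :=
  \sum_(1 <= j < n) (sin (ang (j * l)%N) * sin (ang j)) / (2 * dist j ^+ 3).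
Definition Qcoef (l : nat) : R :=
  \sum_(1 <= j < n) (cos (ang j) - cos (ang (j * l)%N)) / (2 * dist j ^+ 3).

Definition acoef l : R := Pcoef l - 3 * Qcoef l.
Definition bcoef l : R := Pcoef l + 3 * Qcoef l.

Definition U_first : 'M[R]_2 := (zcoef / lam)%:M.

Definition U_half l : 'M[R]_2 :=
  lam^-1 *: \matrix_(i, j)
    nth 0 (nth [::] [:: [:: acoef l; 0];
                        [:: 0; bcoef l]] i) j.

Definition U_middle l : 'M[R]_4 :=
  lam^-1 *: \matrix_(i, j)
    nth 0 (nth [::] [:: [:: acoef l; 0; 0; Scoef l];
                        [:: 0; bcoef l; - Scoef l; 0];
                        [:: 0; - Scoef l; acoef l; 0];
                        [:: Scoef l; 0; 0; bcoef l]] i) j.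

Definition small_block (l : nat) : bool := (l == 1%N) || (l.*2 == n).

Definition Usize (l : nat) : nat := (if small_block l then 2 else 4)%N.

Definition Umx (l : nat) : 'M[R]_(Usize l) :=
  match small_block l as b return 'M[R]_((if b then 2 else 4)%N) with
  | true => if l == 1%N then U_first else U_half l
  | false => U_middle l
  end.

Variable e : R.

Definition Bblock (l : nat) (theta : R) : 'M[R]_(Usize l + Usize l) :=
  block_mx 1%:M (- Jdiag _)
           (Jdiag _) (1%:M - (1 + e * cos theta)^-1 *: (1%:M + Umx l)).

Fixpoint Bsize (k : nat) : nat :=
  if k is k'.+1 then (Bsize k' + Usize k'.+2)%N else Usize 1%N.

(* B_1 <> ... <> B_(k+1) *)
Fixpoint Bdiamond (k : nat) (theta : R) : 'M[R]_(Bsize k + Bsize k) :=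
  match k return 'M[R]_(Bsize k + Bsize k) with
  | 0%N => Bblock 1%N theta
  | k'.+1 => diamond (Bdiamond k' theta) (Bblock k'.+2 theta)
  end.

Definition ess_size : nat := Bsize n./2.-1.

(* B_3 = B_1 <> ... <> B_[n/2], meaningful for n >= 3, of size
   2 * ess_size = 4 n - 8. *)
Definition B_ess (theta : R) : 'M[R]_(ess_size + ess_size) :=
  Bdiamond n./2.-1 theta.

End RegularPolygon.

(* For 0 <= e < 1 the system is linear with continuous coefficients, so eta exists
   on [0, 2 pi] and is unique there: this is a statement about one monodromy matrix. *)
Definition ERE_hyperbolic (R : realType) (n : nat) (e : R) : Prop :=
  forall eta : R -> 'M[R]_(ess_size n + ess_size n),
    fundamental_solution (B_ess n e) eta ->
    no_unit_circle_eigenvalue (eta (2 * pi)).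

(* Main.v *)
(** Hyperbolicity is certified by a quadratic Lyapunov function: if [W^T L(t) W],
with [L] symmetric and 2 pi-periodic, strictly increases along all nonzero
solutions, then the real and imaginary parts of an eigenvector for a unit
eigenvalue would start two solutions on which the values of the form have the same sum
at [0] and at [2 pi], a contradiction.  Such certificates are compatible with the
symplectic sum.

On a block, with [q = 1 + e cos t], [w2 = x] and [w1 = x' + J x], the system is
[x'' + 2 J x' = q^-1 (I + U) x].  Take [W^T L W = 2 (<x, x'> + <K x, x>)] with
[K = - s (q'/q) A + J A - J], where [s] is a scalar and [A] a diagonal matrix of
pattern [a, 2 - a].  Completing the square, and using [q'' = 1 - q], half its
derivative is [|x' + (K + J) x|^2] plus a form in [x] that is positive as soon as
[I + U - s A], [I + U + s A - 2 s^2 A^2] and [I + U + s A - 2 A^2] are positive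
definite.  For [U > 0] the choice [s = 1], [A = I] works; this settles [U_1].
For n = 4, 5 the block [U_2] is indefinite, and suitable values of [a] and [s] are
given explicitly. *)
From HB Require Import structures.
Require Import Defs.
From mathcomp Require Import all_boot all_order all_algebra.
From mathcomp Require Import all_classical all_reals all_analysis.
From mathcomp Require Import complex ring lra.

Set Implicit Arguments.
Unset Strict Implicit.
Unset Printing Implicit Defensive.

Import Order.TTheory GRing.Theory Num.Theory.
Import numFieldNormedType.Exports.

Local Open Scope classical_set_scope.
Local Open Scope ring_scope.

(** * Eigenvalues on the unit circle, in real form *)

Section UnitEigenvalue.
Context {R : realType}.

(** [eigenvalue] is defined through row vectors. The transpose of a singular [A - a I] is singular
    too, and a row in its left kernel transposes to the column sought. *)
Lemma eigenvalue_colP (F : fieldType) N (A : 'M[F]_N) a :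
  eigenvalue A a -> exists2 u : 'cV_N, u != 0 & A *m u = a *: u.
Proof.
rewrite /eigenvalue /eigenspace kermx_eq0 row_free_unit -unitmx_tr.
rewrite -row_free_unit -kermx_eq0 => /rowV0Pn[v /sub_kermxP vA v0].
exists v^T; first by rewrite -(inj_eq trmx_inj) trmxK trmx0.
apply: trmx_inj; move/eqP: vA; rewrite linearB/= mulmxBr subr_eq0 => /eqP vA.
by rewrite trmx_mul trmxK vA tr_scalar_mx mul_mx_scalar linearZ/= trmxK.
Qed.

(** As [M] is real, it commutes with taking real and imaginary parts: with [w = c + i s] and
    [u = p + i r], these are the two parts of [M u = w u]. *)
Lemma unit_eigenvalue_rotation N (M : 'M[R]_N) (w : R[i]) :
  `|w| = 1 -> eigenvalue (map_mx (real_complex R) M) w ->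
  exists p r : 'cV[R]_N, exists c s : R,
    [/\ (p != 0) || (r != 0), c ^+ 2 + s ^+ 2 = 1,
        M *m p = c *: p - s *: r & M *m r = s *: p + c *: r].
Proof.
move=> w1 /eigenvalue_colP[u u0 Mu].
exists (map_mx (@complex.Re R) u), (map_mx (@complex.Im R) u), (complex.Re w),
  (complex.Im w).
have ReIm_mul i : (M *m map_mx (@complex.Re R) u) i 0 = complex.Re (w * u i 0) /\
    (M *m map_mx (@complex.Im R) u) i 0 = complex.Im (w * u i 0).
  move/matrixP : Mu => /(_ i 0); rewrite !mxE => <-.
  elim/big_rec3 : _ => //= j x y z _ [-> ->].
  by rewrite !mxE; case: (u j 0) => a b; case: y => a' b' /=; split; ring.
split.
- apply: contraNT u0; rewrite negb_or !negbK => /andP[/eqP/matrixP p0 /eqP/matrixP r0].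
  apply/eqP/matrixP => i j; move: (p0 i j) (r0 i j); rewrite !mxE.
  by case: (u i j) => a b /= -> ->.
- by have := add_Re2_Im2 w; rewrite w1 expr1n => /(congr1 (@complex.Re R)).
- apply/matrixP => i j; rewrite ord1 (ReIm_mul i).1 !mxE.
  by case: w {w1 Mu ReIm_mul} => c s; case: (u i 0) => a b /=.
- apply/matrixP => i j; rewrite ord1 (ReIm_mul i).2 !mxE.
  by case: w {w1 Mu ReIm_mul} => c s; case: (u i 0) => a b /=; ring.
Qed.

End UnitEigenvalue.

(** * Entrywise differentiation and continuity of matrix-valued functions *)

Section MatrixCalculus.
Context {R : realType}.

Lemma is_derive_mxP m n (F : R -> 'M[R]_(m, n)) (t : R) (dF : 'M[R]_(m, n)) :
  is_derive t (1 : R) F dF <->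
  forall i j, is_derive t (1 : R) (fun x => F x i j) (dF i j).
Proof.
split=> [[Fd <-] i j|FdF].
  have /derivable_mxP Fijd := Fd.
  by apply: DeriveDef => //; rewrite derive_mx// mxE.
have Fd : derivable F t 1 by apply/derivable_mxP => i j; case: (FdF i j).
apply: DeriveDef => //; rewrite derive_mx//; apply/matrixP => i j.
by rewrite mxE; case: (FdF i j).
Qed.

Lemma is_derive_mulmx m n p (F : R -> 'M[R]_(m, n)) (G : R -> 'M[R]_(n, p)) (t : R)
    (dF : 'M[R]_(m, n)) (dG : 'M[R]_(n, p)) :
  is_derive t (1 : R) F dF -> is_derive t (1 : R) G dG ->
  is_derive t (1 : R) (fun x => F x *m G x) (dF *m G t + F t *m dG).
Proof.
move=> /is_derive_mxP FdF /is_derive_mxP GdG; apply/is_derive_mxP => i j.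
have FG k := is_deriveM (FdF i k) (GdG k j).
move: (is_derive_sum FG); rewrite fct_sumE => FGd.
under [X in is_derive _ _ X]eq_fun do rewrite mxE.
apply: (is_derive_eq FGd); rewrite !mxE -big_split/=.
by apply: eq_bigr => k _; rewrite addrC; congr (_ + _); exact: mulrC.
Qed.

Lemma within_continuous_mulmx (A : set R) m n p
    (F : R -> 'M[R]_(m, n)) (G : R -> 'M[R]_(n, p)) :
  (forall i j, {within A, continuous (fun x => F x i j)}) ->
  (forall i j, {within A, continuous (fun x => G x i j)}) ->
  forall i j, {within A, continuous (fun x => (F x *m G x) i j)}.
Proof.
move=> cF cG i j.
rewrite (_ : (fun x => _) = (fun x => \sum_k F x i k * G x k j)); last first.
  by apply/funext => x; rewrite mxE.
apply: (continuous_big add_continuous) => k _ x.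
by apply: cvgM; [exact: cF|exact: cG].
Qed.

End MatrixCalculus.

(** * A quadratic Lyapunov certificate excludes unit eigenvalues *)

Section Lyapunov.
Context {R : realType}.

Definition quad_form m (L : 'M[R]_m) (W : 'cV[R]_m) : R := (W^T *m L *m W) 0 0.

Lemma quad_formD m (L M : 'M[R]_m) W :
  quad_form (L + M) W = quad_form L W + quad_form M W.
Proof. by rewrite /quad_form mulmxDr mulmxDl mxE. Qed.

Lemma quad_formZ m (k : R) (L : 'M[R]_m) W : quad_form (k *: L) W = k * quad_form L W.
Proof. by rewrite /quad_form -scalemxAr -scalemxAl mxE. Qed.

Lemma quad_form0 m (L : 'M[R]_m) : quad_form L 0 = 0.
Proof. by rewrite /quad_form mulmx0 mxE. Qed.

Lemma quad_form_lin m (L : 'M[R]_m) (p r : 'cV[R]_m) (a b : R) :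
  quad_form L (a *: p + b *: r) =
  a ^+ 2 * quad_form L p + a * b * ((p^T *m L *m r) 0 0 + (r^T *m L *m p) 0 0) +
  b ^+ 2 * quad_form L r.
Proof.
rewrite /quad_form.
have -> : (a *: p + b *: r)^T = a *: p^T + b *: r^T.
  by apply/matrixP => i j; rewrite !mxE.
rewrite !(mulmxDl, mulmxDr) -!(scalemxAl, scalemxAr).
move: (p^T *m L *m p) (p^T *m L *m r) (r^T *m L *m p) (r^T *m L *m r).
by move=> pp pr rp rr; rewrite !mxE; ring.
Qed.

(** The cross terms of the two values are opposite, and the squares combine through
    [c ^+ 2 + s ^+ 2 = 1]. *)
Lemma quad_form_rotation m (L : 'M[R]_m) (p r : 'cV[R]_m) (c s : R) :
  c ^+ 2 + s ^+ 2 = 1 ->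
  quad_form L (c *: p - s *: r) + quad_form L (s *: p + c *: r) =
  quad_form L p + quad_form L r.
Proof.
move=> cs1; rewrite -scaleNr !quad_form_lin.
transitivity ((c ^+ 2 + s ^+ 2) * (quad_form L p + quad_form L r)); first by ring.
by rewrite cs1 mul1r.
Qed.

(** A 1 x 1 matrix equals its transpose, so for symmetric [L] the terms [X'^T L X] and [X^T L X']
    coincide; this gives the factor 2. *)
Lemma is_derive_quad_form m (L : R -> 'M[R]_m) (X : R -> 'cV[R]_m) (t : R)
    (dL A : 'M[R]_m) :
  (L t)^T = L t ->
  is_derive t (1 : R) L dL -> is_derive t (1 : R) X (A *m X t) ->
  is_derive t (1 : R) (fun x => quad_form (L x) (X x))
    (quad_form (dL + 2 *: (L t *m A)) (X t)).
Proof.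
move=> Lsym LdL XAX.
have XTd : is_derive t (1 : R) (fun x => (X x)^T) (A *m X t)^T.
  apply/is_derive_mxP => i j; under eq_fun do rewrite mxE.
  by rewrite mxE; move/is_derive_mxP : XAX.
have /is_derive_mxP/(_ 0 0) := is_derive_mulmx (is_derive_mulmx XTd LdL) XAX.
move/is_derive_eq; apply; rewrite quad_formD quad_formZ /quad_form.
have tr1 (M : 'M[R]_1) : M^T = M by apply/matrixP => i j; rewrite mxE !ord1.
have -> : ((A *m X t)^T *m L t + (X t)^T *m dL) *m X t + (X t)^T *m L t *m (A *m X t) =
    (X t)^T *m dL *m X t + 2 *: ((X t)^T *m (L t *m A) *m X t).
  rewrite mulmxDl -[(A *m X t)^T *m L t *m X t]tr1 !trmx_mul !trmxK Lsym !mulmxA.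
  by rewrite addrAC [LHS]addrC scaler_nat mulr2n.
by rewrite !mxE.
Qed.

(** The form in the last clause is the derivative of [W^T L W] along [W' = J B W]; it is required to
    be positive at every vector, without reference to solutions. *)
Definition lyapunov m (B : R -> 'M[R]_(m + m)) : Prop :=
  exists L dL : R -> 'M[R]_(m + m),
  [/\ forall t, (L t)^T = L t,
      L (2 * pi) = L 0,
      forall t, is_derive t (1 : R) L (dL t) &
      forall t W, W != 0 ->
        0 < quad_form (dL t + 2 *: (L t *m (Jmx m *m B t))) W].

(** The mean value theorem on [[a, t0]] and on [[t0, b]] gives two nonnegative increments with sum
    zero, so both vanish. The free choice of [t0] brings the critical point as close to [a] as
    desired. *)
Lemma nondecreasing_loop_critical (g dg : R -> R) (a b t0 : R) :
  (forall t, t \in `]a, b[ -> is_derive t (1 : R) g (dg t)) ->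
  {within `[a, b], continuous g} -> (forall t, 0 <= dg t) -> g b = g a ->
  a < t0 < b -> exists2 t, a < t < t0 & dg t = 0.
Proof.
move=> gd gc dg_ge0 gab /andP[at0 t0b].
have gd1 x : x \in `]a, t0[ -> is_derive x (1 : R) g (dg x).
  by rewrite in_itv/= => /andP[ax xt0]; apply: gd; rewrite in_itv/= ax (lt_trans xt0).
have gd2 x : x \in `]t0, b[ -> is_derive x (1 : R) g (dg x).
  by rewrite in_itv/= => /andP[t0x xb]; apply: gd; rewrite in_itv/= xb (lt_trans at0).
have gc1 : {within `[a, t0], continuous g}.
  apply: continuous_subspaceW gc => x/=; rewrite !in_itv/= => /andP[-> xt0]/=.
  by rewrite (le_trans xt0)// ltW.
have gc2 : {within `[t0, b], continuous g}.
  apply: continuous_subspaceW gc => x/=; rewrite !in_itv/= => /andP[t0x ->].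
  by rewrite (le_trans _ t0x)// ltW.
have [t tat0 gt] := MVT at0 gd1 gc1.
have [t' _ gt'] := MVT t0b gd2 gc2.
exists t; first by rewrite in_itv in tat0.
apply/eqP; rewrite eq_le dg_ge0 andbT -(pmulr_lle0 _ (_ : 0 < t0 - a)) ?subr_gt0//.
have : 0 <= dg t' * (b - t0) by rewrite mulr_ge0// subr_ge0 ltW.
by rewrite -gt -gt' gab; lra.
Qed.

(** Uniqueness of solutions is avoided: equal values of the form at both ends force the two
    solutions to vanish together at times arbitrarily close to 0, whereas one of them starts at a
    nonzero vector and is continuous. *)
Lemma lyapunov_hyperbolic m (B eta : R -> 'M[R]_(m + m)) :
  lyapunov B -> fundamental_solution B eta ->
  no_unit_circle_eigenvalue (eta (2 * pi)).
Proof.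
move=> [L [dL [Lsym Lper LdL pos]]] [eta0 etac etad] w w1; apply/negP.
move=> /(unit_eigenvalue_rotation w1)[p [r [c [s [pr0 cs1 Mp Mr]]]]].
pose sol (u : 'cV[R]_(m + m)) t := eta t *m u.
have sold u t : t \in `]0, 2 * pi[ ->
    is_derive t (1 : R) (sol u) (Jmx m *m B t *m sol u t).
  move=> /etad ed; have := is_derive_mulmx ed (is_derive_cst u t 1).
  by move/is_derive_eq; apply; rewrite mulmx0 addr0 mulmxA.
have solc u i j : {within `[0, 2 * pi], continuous (fun t => sol u t i j)}.
  apply: within_continuous_mulmx => k l; last by move=> ?; exact: cvg_cst.
  move=> x; apply: (cvg_comp _ (fun M : 'M[R]_(m + m) => M k l) (etac x)).
  exact: coord_continuous.
pose D u t := quad_form (dL t + 2 *: (L t *m (Jmx m *m B t))) (sol u t).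
pose g t := quad_form (L t) (sol p t) + quad_form (L t) (sol r t).
have gd t : t \in `]0, 2 * pi[ -> is_derive t (1 : R) g (D p t + D r t).
  by move=> t02; apply: is_deriveD; apply: is_derive_quad_form => //; exact: sold.
have gc : {within `[0, 2 * pi], continuous g}.
  have qc u : {within `[0, 2 * pi], continuous (fun t => quad_form (L t) (sol u t))}.
    apply: within_continuous_mulmx; last exact: solc.
    apply: within_continuous_mulmx => [i j|i j].
      rewrite (_ : (fun t => _) = (fun t => sol u t j i)); first exact: solc.
      by apply/funext => t; rewrite mxE.
    apply: continuous_subspaceT => t; apply/differentiable_continuous.
    by apply/derivable1_diffP; have /is_derive_mxP/(_ i j)[] := LdL t.
  by move=> x; apply: cvgD; exact: qc.
have D_ge0 u t : 0 <= D u t.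
  have [sol0|sol_neq0] := eqVneq (sol u t) 0; last exact/ltW/pos.
  by rewrite /D sol0 quad_form0.
have D_eq0 u t : D u t = 0 -> sol u t = 0.
  by move=> D0; apply: contraTeq isT => /(pos t); rewrite -/(D u t) D0 ltxx.
have pi2_gt0 : 0 < 2 * pi :> R by rewrite mulr_gt0// pi_gt0.
(* The monodromy rotates the pair [(p, r)], which preserves the sum of the two values, and [L] is
   periodic. *)
have g02 : g (2 * pi) = g 0.
  by rewrite /g /sol Mp Mr quad_form_rotation// Lper eta0 !mul1mx.
have zero_sol (t0 : R) : 0 < t0 < 2 * pi ->
    exists2 t, 0 < t < t0 & sol p t = 0 /\ sol r t = 0.
  move=> t02; have DD_ge0 t : 0 <= D p t + D r t by rewrite addr_ge0.
  have [t tt0 DD0] := nondecreasing_loop_critical gd gc DD_ge0 g02 t02.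
  exists t => //; move/eqP: DD0; rewrite paddr_eq0// => /andP[/eqP Dp /eqP Dr].
  by split; exact: D_eq0.
have sol_start (u : 'cV[R]_(m + m)) i : u i 0 != 0 ->
    exists2 t0 : R, 0 < t0 < 2 * pi & forall t, 0 < t < t0 -> sol u t i 0 != 0.
  move=> ui0; move: (solc u i 0) => /(continuous_within_itvP _ pi2_gt0)[_ + _].
  rewrite /sol eta0 mul1mx => /cvgr_neq0 /(_ ui0).
  (* Halving the minimum keeps [t0] inside the period and below the radius [d] on which the
     coordinate stays nonzero. *)
  case=> d /= d0 dP; exists (Num.min d (2 * pi) / 2).
    by case: (ltrP d (2 * pi)) => ?; lra.
  move=> t /andP[t0 td]; apply: dP => //=; rewrite sub0r normrN gtr0_norm//.
  by move: td; case: (ltrP d (2 * pi)) => ?; lra.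
have [i [u [ui0 uE]]] : exists i (u : 'cV[R]_(m + m)), u i 0 != 0 /\ (u = p \/ u = r).
  by case/orP: pr0 => /cV0Pn[i ui0]; exists i;
    [exists p; split=> //; left|exists r; split=> //; right].
have [t0 /zero_sol[t tt0 [p0 r0]] /(_ t tt0)] := sol_start u i ui0.
by case: uE => ->; rewrite ?p0 ?r0 mxE eqxx.
Qed.

End Lyapunov.

(** * Certificates and the symplectic sum *)

Section Diamond.
Context {R : realType}.

Lemma is_derive_block_mx m1 m2 n1 n2 (t : R)
    (A : R -> 'M[R]_(m1, n1)) (B : R -> 'M[R]_(m1, n2))
    (C : R -> 'M[R]_(m2, n1)) (D : R -> 'M[R]_(m2, n2)) dA dB dC dD :
  is_derive t (1 : R) A dA -> is_derive t (1 : R) B dB ->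
  is_derive t (1 : R) C dC -> is_derive t (1 : R) D dD ->
  is_derive t (1 : R) (fun x => block_mx (A x) (B x) (C x) (D x))
    (block_mx dA dB dC dD).
Proof.
move=> /is_derive_mxP hA /is_derive_mxP hB /is_derive_mxP hC /is_derive_mxP hD.
apply/is_derive_mxP => i j.
case: (split_ordP i) => i' ->; case: (split_ordP j) => j' ->.
- rewrite block_mxEul (_ : (fun x => _) = (fun x => A x i' j'))//.
  by apply/funext => x; rewrite block_mxEul.
- rewrite block_mxEur (_ : (fun x => _) = (fun x => B x i' j'))//.
  by apply/funext => x; rewrite block_mxEur.
- rewrite block_mxEdl (_ : (fun x => _) = (fun x => C x i' j'))//.
  by apply/funext => x; rewrite block_mxEdl.
- rewrite block_mxEdr (_ : (fun x => _) = (fun x => D x i' j'))//.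
  by apply/funext => x; rewrite block_mxEdr.
Qed.

Lemma is_derive_submatrix m n m' n' (S : 'M[R]_(m, n) -> 'M[R]_(m', n'))
    (f : 'I_m' -> 'I_m) (g : 'I_n' -> 'I_n) (F : R -> 'M[R]_(m, n)) (t : R) dF :
  (forall M i j, S M i j = M (f i) (g j)) ->
  is_derive t (1 : R) F dF -> is_derive t (1 : R) (fun x => S (F x)) (S dF).
Proof.
move=> SE /is_derive_mxP FdF; apply/is_derive_mxP => i j; rewrite SE.
rewrite (_ : (fun x => _) = (fun x => F x (f i) (g j)))//.
by apply/funext => x; rewrite SE.
Qed.

Lemma is_derive_diamond m k (F : R -> 'M[R]_(m + m)) (G : R -> 'M[R]_(k + k))
    (t : R) dF dG :
  is_derive t (1 : R) F dF -> is_derive t (1 : R) G dG ->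
  is_derive t (1 : R) (fun x => diamond (F x) (G x)) (diamond dF dG).
Proof.
move=> Fd Gd; rewrite /diamond.
have z p q : is_derive t (1 : R) (fun=> 0 : 'M[R]_(p, q)) 0 by exact: is_derive_cst.
have ul p (H : R -> 'M[R]_(p + p)) dH : is_derive t (1 : R) H dH ->
    is_derive t (1 : R) (fun x => ulsubmx (H x)) (ulsubmx dH).
  by apply: is_derive_submatrix => M i j; rewrite !mxE.
have ur p (H : R -> 'M[R]_(p + p)) dH : is_derive t (1 : R) H dH ->
    is_derive t (1 : R) (fun x => ursubmx (H x)) (ursubmx dH).
  by apply: is_derive_submatrix => M i j; rewrite !mxE.
have dl p (H : R -> 'M[R]_(p + p)) dH : is_derive t (1 : R) H dH ->
    is_derive t (1 : R) (fun x => dlsubmx (H x)) (dlsubmx dH).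
  by apply: is_derive_submatrix => M i j; rewrite !mxE.
have dr p (H : R -> 'M[R]_(p + p)) dH : is_derive t (1 : R) H dH ->
    is_derive t (1 : R) (fun x => drsubmx (H x)) (drsubmx dH).
  by apply: is_derive_submatrix => M i j; rewrite !mxE.
by apply: is_derive_block_mx; apply: is_derive_block_mx; auto.
Qed.

Section Algebra.
Variables m k : nat.
Implicit Types (M N : 'M[R]_(m + m)) (P Q : 'M[R]_(k + k)).

Lemma diamond_block A1 B1 C1 D1 A2 B2 C2 D2 :
  diamond (block_mx A1 B1 C1 D1 : 'M[R]_(m + m)) (block_mx A2 B2 C2 D2 : 'M[R]_(k + k)) =
  block_mx (block_mx A1 0 0 A2) (block_mx B1 0 0 B2)
           (block_mx C1 0 0 C2) (block_mx D1 0 0 D2).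
Proof. by rewrite /diamond !(block_mxKul, block_mxKur, block_mxKdl, block_mxKdr). Qed.

Lemma diamondM M N P Q :
  diamond M P *m diamond N Q = diamond (M *m N) (P *m Q).
Proof.
rewrite -[in RHS](submxK M) -[in RHS](submxK N) -[in RHS](submxK P).
rewrite -[in RHS](submxK Q) ![in RHS]mulmx_block diamond_block /diamond !mulmx_block.
by rewrite !(mulmx0, mul0mx, addr0, add0r) !add_block_mx !(addr0, add0r).
Qed.

Lemma diamondD M N P Q : diamond M P + diamond N Q = diamond (M + N) (P + Q).
Proof. by rewrite /diamond !add_block_mx !addr0 -!linearD. Qed.

Lemma diamondZ (a : R) M P : a *: diamond M P = diamond (a *: M) (a *: P).
Proof. by rewrite /diamond !scale_block_mx !scaler0 -!linearZ. Qed.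

Lemma tr_diamond M P : (diamond M P)^T = diamond M^T P^T.
Proof.
rewrite /diamond !tr_block_mx !trmx0.
by rewrite !(trmx_ulsub, trmx_ursub, trmx_dlsub, trmx_drsub).
Qed.

Lemma Jmx_diamond : Jmx (m + k) = diamond (Jmx m) (Jmx k) :> 'M[R]_(_).
Proof.
rewrite /Jmx diamond_block -!scalar_mx_block; congr block_mx.
- by rewrite -block_mx0.
- by rewrite (scalar_mx_block m k) opp_block_mx !oppr0.
- by rewrite -block_mx0.
Qed.

(** The symplectic sum interleaves the two factors: each one sees its own part of the upper half of
    [W] and its own part of the lower half. *)
Lemma quad_form_diamond M P (W : 'cV[R]_((m + k) + (m + k))) :
  quad_form (diamond M P) W =
  quad_form M (col_mx (usubmx (usubmx W)) (usubmx (dsubmx W))) +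
  quad_form P (col_mx (dsubmx (usubmx W)) (dsubmx (dsubmx W))).
Proof.
rewrite /quad_form -[in LHS](vsubmxK W) -[in LHS](vsubmxK (usubmx W)).
rewrite -[in LHS](vsubmxK (dsubmx W)).
move: (usubmx (usubmx W)) (usubmx (dsubmx W)) (dsubmx (usubmx W))
  (dsubmx (dsubmx W)) => u1 u2 v1 v2.
rewrite -(submxK M) -(submxK P) diamond_block.
rewrite !tr_col_mx !mul_row_block !mul_row_col !(mulmx0, addr0, add0r).
by rewrite !add_row_mx !mul_row_col addrACA [LHS]mxE.
Qed.

End Algebra.

(** The sum of the two certificates works, because every operation in [lyapunov], including
    multiplication by [Jmx], respects [diamond], and a nonzero vector has a nonzero component in
    some factor. *)
Lemma lyapunov_diamond m k (B : R -> 'M[R]_(m + m)) (C : R -> 'M[R]_(k + k)) :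
  lyapunov B -> lyapunov C -> lyapunov (fun t => diamond (B t) (C t)).
Proof.
move=> [L [dL [Lsym Lper LdL Lpos]]] [M [dM [Msym Mper MdM Mpos]]].
exists (fun t => diamond (L t) (M t)), (fun t => diamond (dL t) (dM t)); split.
- by move=> t; rewrite tr_diamond Lsym Msym.
- by rewrite Lper Mper.
- by move=> t; exact: is_derive_diamond.
move=> t W W0; rewrite Jmx_diamond !diamondM diamondZ diamondD quad_form_diamond.
set u := col_mx _ _; set v := col_mx _ _.
have ge0 (p : nat) (N : 'M[R]_p) (x : 'cV[R]_p) :
    (forall y, y != 0 -> 0 < quad_form N y) -> 0 <= quad_form N x.
  move=> Npos; have [->|x0] := eqVneq x 0; first by rewrite quad_form0.
  exact/ltW/Npos.
have [u0|u0] := eqVneq u 0; last first.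
  by apply: ltr_pwDl; [exact: Lpos|apply: ge0 => y; exact: Mpos].
apply: ltr_wpDl; first by apply: ge0 => y; exact: Lpos.
apply: Mpos; apply: contra_neq W0 => v0.
rewrite -[W]vsubmxK -[usubmx W]vsubmxK -[dsubmx W]vsubmxK.
move/eqP: u0; move/eqP: v0; rewrite !col_mx_eq0.
by move=> /andP[/eqP-> /eqP->] /andP[/eqP-> /eqP->]; rewrite !col_mx0.
Qed.

End Diamond.

(** * The certificate for a single block *)

Section Block.
Context {R : realType}.

Definition dot m (u v : 'cV[R]_m) : R := (u^T *m v) 0 0.

Lemma quad_formE m (L : 'M[R]_m) u : quad_form L u = dot u (L *m u).
Proof. by rewrite /quad_form /dot mulmxA. Qed.

Lemma dotC m (u v : 'cV[R]_m) : dot u v = dot v u.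
Proof. by rewrite /dot !mxE; apply: eq_bigr => i _; rewrite !mxE mulrC. Qed.

Lemma dotDr m (u v w : 'cV[R]_m) : dot u (v + w) = dot u v + dot u w.
Proof. by rewrite /dot mulmxDr mxE. Qed.

Lemma dotNr m (u v : 'cV[R]_m) : dot u (- v) = - dot u v.
Proof. by rewrite /dot mulmxN mxE. Qed.

Lemma dotZr m (u v : 'cV[R]_m) (k : R) : dot u (k *: v) = k * dot u v.
Proof. by rewrite /dot -scalemxAr mxE. Qed.

Lemma dotDl m (u v w : 'cV[R]_m) : dot (v + w) u = dot v u + dot w u.
Proof. by rewrite dotC dotDr !(dotC u). Qed.

Lemma dotNl m (u v : 'cV[R]_m) : dot (- v) u = - dot v u.
Proof. by rewrite dotC dotNr (dotC u). Qed.

Lemma dotZl m (u v : 'cV[R]_m) (k : R) : dot (k *: v) u = k * dot v u.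
Proof. by rewrite dotC dotZr (dotC u). Qed.

Lemma dot_mulmxl m n (M : 'M[R]_(m, n)) u v : dot (M *m u) v = dot u (M^T *m v).
Proof. by rewrite /dot trmx_mul mulmxA. Qed.

Lemma dot_ge0 m (u : 'cV[R]_m) : 0 <= dot u u.
Proof. by rewrite /dot mxE sumr_ge0// => i _; rewrite mxE -expr2 sqr_ge0. Qed.

Lemma dot_gt0 m (u : 'cV[R]_m) : u != 0 -> 0 < dot u u.
Proof.
move=> /cV0Pn[i ui0]; rewrite /dot mxE (bigD1 i)//= mxE.
by rewrite ltr_pwDl ?lt0r ?mulf_neq0 -?expr2 ?sqr_ge0// sumr_ge0// => j _;
  rewrite mxE -expr2 sqr_ge0.
Qed.

Lemma quad_form_block m n (A : 'M[R]_m) (B : 'M[R]_(m, n)) (C : 'M[R]_(n, m))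
    (D : 'M[R]_n) u v :
  quad_form (block_mx A B C D) (col_mx u v) =
  dot u (A *m u) + dot u (B *m v) + dot v (C *m u) + dot v (D *m v).
Proof.
rewrite quad_formE mul_block_col {1}/dot tr_col_mx mul_row_col mxE.
by rewrite -2!/(dot _ _) !dotDr addrA.
Qed.

Lemma tr_Jdiag m : (Jdiag m)^T = - Jdiag m :> 'M[R]_m.
Proof.
apply/matrixP => i j; rewrite !mxE.
have [ji|ji] := eqVneq (nat_of_ord j) i.+1; rewrite ?andbT ?andbF ?ji.
  by rewrite ltn_eqF ?andbF//= ; case: odd; rewrite ?oppr0 ?opprK.
by case: (_ && _); rewrite ?oppr0.
Qed.

(* Minus the logarithmic derivative of [1 + e cos]. *)
Definition kap (e t : R) : R := e * sin t / (1 + e * cos t).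

Lemma ecos_bound (e t : R) : 0 <= e < 1 -> 0 < 1 + e * cos t < 2.
Proof.
move=> /andP[e0 e1]; have /andP[c1 c2] : -1 <= cos t <= 1 by rewrite cos_geN1 cos_le1.
by apply/andP; split; nra.
Qed.

Lemma is_derive_kap (e t : R) : 0 <= e < 1 ->
  is_derive t (1 : R) (kap e)
    (e * cos t / (1 + e * cos t) + kap e t ^+ 2).
Proof.
move=> e01; have q0 : 1 + e * cos t != 0.
  by rewrite gt_eqF//; case/andP: (ecos_bound t e01).
have num : is_derive t (1 : R) (e *: sin) (e * cos t) by exact: is_deriveZ.
have den : is_derive t (1 : R) (cst 1 + e *: cos) (0 + e * - sin t).
  by apply: is_deriveD; exact: is_deriveZ.
have inv := @is_deriveV R (cst 1 + e *: cos) t _ (1 : R) q0 den.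
apply: (is_derive_eq (is_deriveM num inv)).
rewrite /kap !fctE /GRing.scale/=; field.
by rewrite q0.
Qed.

Lemma is_derive_affine_mx m n (f : R -> R) (t df : R) (M N : 'M[R]_(m, n)) :
  is_derive t (1 : R) f df ->
  is_derive t (1 : R) (fun x => f x *: M + N) (df *: M).
Proof.
move=> fdf; apply/is_derive_mxP => i j.
have := is_deriveD (is_deriveZ (M i j) fdf) (is_derive_cst (N i j) t (1 : R)).
rewrite (_ : _ + cst _ = (fun x => (f x *: M + N) i j)); last first.
  by apply/funext => x; rewrite !mxE mulrC.
by move/is_derive_eq; apply; rewrite !mxE addr0 mulrC.
Qed.

(** As [J] is skew, its two terms coupling [u] and [v] cancel and [2 <u, K v>] remains; as [J] is
    orthogonal, [- |v|^2 - 2 <K v, J v>] equals [|K v|^2 - |(K + J) v|^2]. *)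
Lemma complete_square m (J K N : 'M[R]_m) (u v : 'cV[R]_m) :
  J^T = - J -> J^T *m J = 1%:M -> K^T = K ->
  dot u u + dot u (- (J *m v)) + dot v ((2 *: K - J) *m u) +
    dot v ((N - 1%:M - 2 *: (K *m J)) *m v) =
  dot (u + K *m v) (u + K *m v) +
    (dot v (N *m v) - dot ((K + J) *m v) ((K + J) *m v)).
Proof.
move=> Jskew JJ Ksym.
have KE x y : dot x (K *m y) = dot (K *m x) y by rewrite dot_mulmxl Ksym.
have JE x y : dot x (J *m y) = - dot (J *m x) y.
  by rewrite dot_mulmxl Jskew mulNmx dotNr opprK.
have JvJv : dot (J *m v) (J *m v) = dot v v by rewrite dot_mulmxl mulmxA JJ mul1mx.
rewrite !mulmxDl !mulNmx !mul1mx -!scalemxAl -mulmxA.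
rewrite !(dotDl, dotDr, dotNr, dotNl, dotZr) JvJv (JE v u) (KE v u) (KE v (J *m v)).
rewrite (dotC u (J *m v)) (dotC u (K *m v)) (dotC (J *m v) (K *m v)).
by ring.
Qed.

(* After clearing denominators the form is affine in [z] on [0 <= z <= q (2 - q)] and,
   at both ends, [q] times an affine function of [q]: the three hypotheses are the
   values at the corners. *)
Lemma lyapunov_pointwise (q z s r x y : R) :
  0 < q < 2 -> 0 <= z -> z + (q - 1) ^+ 2 < 1 ->
  s * x < r -> 2 * s ^+ 2 * y < r + s * x -> 2 * y < r + s * x ->
  0 < s * ((q - 1) / q + z / q ^+ 2) * x + r / q - (s ^+ 2 * (z / q ^+ 2) + 1) * y.
Proof.
move=> /andP[q0 q2] z0 zq rA rB rC.
rewrite -(pmulr_rgt0 _ (_ : 0 < 2 * q ^+ 2 * (2 - q))); last first.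
  by rewrite !mulr_gt0// ?exprn_gt0// subr_gt0.
have -> : 2 * q ^+ 2 * (2 - q) * (s * ((q - 1) / q + z / q ^+ 2) * x + r / q
    - (s ^+ 2 * (z / q ^+ 2) + 1) * y) =
  (q * (2 - q) - z) * ((2 - q) * (r - s * x) + q * (r + s * x - 2 * y)) +
  z * ((2 - q) * (r + s * x - 2 * s ^+ 2 * y) + q * (r + s * x - 2 * y)).
  by field; rewrite gt_eqF.
have pos u v : 0 < u -> 0 < v -> 0 < (2 - q) * u + q * v.
  by move=> u0 v0; rewrite addr_gt0// mulr_gt0// subr_gt0.
(* Strictness comes from the first product: [q (2 - q) - z > 0] is the hypothesis
   [z + (q - 1) ^+ 2 < 1], while [z] itself may vanish. *)
apply: ltr_pwDl; [apply: mulr_gt0|apply: mulr_ge0 => //; apply: ltW]; last 1 first.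
- by apply: pos; rewrite subr_gt0.
- by rewrite subr_gt0; nra.
- by apply: pos; rewrite subr_gt0.
Qed.

(* The hypotheses on [J A] make [K + J = s kap A + J A] satisfy
   [|(K + J) x|^2 = (s^2 kap^2 + 1) |A x|^2]. *)
Lemma lyapunov_block m (e s : R) (U A : 'M[R]_m) :
  0 <= e < 1 ->
  (Jdiag m)^T *m Jdiag m = 1%:M :> 'M[R]_m ->
  A^T = A -> (Jdiag m *m (A - 1%:M))^T = Jdiag m *m (A - 1%:M) ->
  (forall x, x != 0 ->
    let r := dot x x + dot x (U *m x) in let a := dot x (A *m x) in
    let a2 := dot (A *m x) (A *m x) in
    [/\ s * a < r, 2 * s ^+ 2 * a2 < r + s * a & 2 * a2 < r + s * a]) ->
  lyapunov (fun t => block_mx 1%:M (- Jdiag m)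
    (Jdiag m) (1%:M - (1 + e * cos t)^-1 *: (1%:M + U))).
Proof.
move=> e01 JJ Asym Esym posR.
set J := Jdiag m in JJ Esym *; set E := J *m (A - 1%:M) in Esym.
pose K t := (kap e t * s) *: A + E.
pose dK t := ((e * cos t / (1 + e * cos t) + kap e t ^+ 2) * s) *: A.
have Ksym t : (K t)^T = K t.
  by apply/matrixP => i j; move/matrixP: Asym => /(_ i j);
    move/matrixP: Esym => /(_ i j); rewrite !mxE => -> ->.
exists (fun t => block_mx 0 1%:M 1%:M (2 *: K t)), (fun t => block_mx 0 0 0 (2 *: dK t)).
split.
- by move=> t; rewrite tr_block_mx trmx0 !tr_scalar_mx linearZ/= Ksym.
(* The time dependence of [K] is only through [kap], which vanishes at both ends. *)
- by rewrite /K /kap mulr_natl sin2pi sin0 !mulr0 !mul0r.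
- move=> t; apply: is_derive_block_mx; try exact: is_derive_cst.
  rewrite (_ : (fun x => _) = (fun x => kap e x *: ((2 * s) *: A) + 2 *: E)).
    rewrite (_ : 2 *: dK t =
        (e * cos t / (1 + e * cos t) + kap e t ^+ 2) *: ((2 * s) *: A)).
      exact/is_derive_affine_mx/is_derive_kap.
    by rewrite !scalerA mulrCA.
  by apply/funext => x; rewrite /K scalerDr !scalerA mulrCA mulrA.
move=> t W W0.
have [w1 [w2 Ww]] : exists w1 w2, W = col_mx w1 w2.
  by exists (usubmx W), (dsubmx W); rewrite vsubmxK.
have -> : block_mx 0 0 0 (2 *: dK t) + 2 *: (block_mx 0 1%:M 1%:M (2 *: K t) *m (Jmx m *m
    block_mx 1%:M (- J) J (1%:M - (1 + e * cos t)^-1 *: (1%:M + U)))) =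
  2 *: block_mx 1%:M (- J) (2 *: K t - J)
     (dK t - 1%:M + (1 + e * cos t)^-1 *: (1%:M + U) - 2 *: (K t *m J)).
  rewrite /Jmx !mulmx_block !(mul0mx, mul1mx, mulmx1, mulNmx, add0r, addr0, opprK).
  rewrite !scale_block_mx add_block_mx !add0r; congr block_mx.
    by rewrite addrC.
  rewrite opprB mulmxN -scalemxAl -scalerDr; congr (_ *: _).
  by rewrite [_ - 1%:M]addrC !addrA.
rewrite quad_formZ mulr_gt0// Ww quad_form_block.
(* The square is completed with [N = dK + q^-1 (I + U)], where [q = 1 + e cos t]. *)
rewrite mul1mx mulNmx (addrAC (dK t)) (complete_square _ _ _ (tr_Jdiag m) JJ (Ksym t)).
have -> : dot ((K t + J) *m w2) ((K t + J) *m w2) =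
    (s ^+ 2 * kap e t ^+ 2 + 1) * dot (A *m w2) (A *m w2).
  have -> : K t + J = (kap e t * s) *: A + J *m A.
    by rewrite /K -addrA /E mulmxBr mulmx1 subrK.
  rewrite mulmxDl -scalemxAl -mulmxA; set y := A *m w2.
  have yJy : dot y (J *m y) = 0.
    have : dot y (J *m y) = - dot y (J *m y).
      by rewrite {1}dotC dot_mulmxl /J tr_Jdiag mulNmx dotNr.
    by lra.
  have JyJy : dot (J *m y) (J *m y) = dot y y by rewrite dot_mulmxl mulmxA JJ mul1mx.
  rewrite !(dotDl, dotDr, dotZr, dotZl) yJy (dotC (J *m y)) yJy JyJy; ring.
(* If [w2 = 0], only [|w1|^2] is left; otherwise the square is dropped and the form in [w2] is shown
   to be positive. *)
have [w20|w20] := eqVneq w2 0.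
  have w10 : w1 != 0 by apply: contra_neq W0 => w10; rewrite Ww w10 w20 col_mx0.
  rewrite w20 !mulmx0 addr0 [dot 0 0]/dot mulmx0 mxE mulr0 subr0 addr0.
  exact: dot_gt0.
apply: ltr_wpDl; first exact: dot_ge0.
have [hA hB hC] := posR _ w20.
rewrite mulmxDl -!scalemxAl dotDr !dotZr mulmxDl mul1mx dotDr.
have kapE : kap e t ^+ 2 = (e * sin t) ^+ 2 / (1 + e * cos t) ^+ 2.
  by rewrite /kap expr_div_n.
(* Here [z = (e sin t)^2], so that [kap^2 = z / q^2] and [z + (q - 1)^2 = e^2 < 1]. *)
have := lyapunov_pointwise (ecos_bound t e01) (sqr_ge0 (e * sin t)) _ hA hB hC.
rewrite [1 + _ - 1]addrC addKr kapE => pos.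
rewrite [_^-1 * _]mulrC [_ * s]mulrC; apply: pos.
rewrite !exprMn -mulrDr sin2cos2 subrK mulr1; case/andP: e01 => e0 e1.
by rewrite expr_lt1.
Qed.

End Block.

(** * Blocks of size 2 and 4: reduction to scalar inequalities *)

Section Blocks.
Context {R : realType}.

Lemma posdef2_ge0 (p q w x y : R) :
  0 < p -> w ^+ 2 < p * q -> 0 <= p * x ^+ 2 + 2 * w * x * y + q * y ^+ 2.
Proof.
move=> p0 wpq; rewrite -(pmulr_rge0 _ p0).
have -> : p * (p * x ^+ 2 + 2 * w * x * y + q * y ^+ 2) =
  (p * x + w * y) ^+ 2 + (p * q - w ^+ 2) * y ^+ 2 by ring.
by rewrite addr_ge0 ?sqr_ge0// mulr_ge0 ?sqr_ge0// subr_ge0 ltW.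
Qed.

Lemma posdef2_gt0 (p q w x y : R) :
  0 < p -> w ^+ 2 < p * q -> (x != 0) || (y != 0) ->
  0 < p * x ^+ 2 + 2 * w * x * y + q * y ^+ 2.
Proof.
move=> p0 wpq xy; rewrite -(pmulr_rgt0 _ p0).
have -> : p * (p * x ^+ 2 + 2 * w * x * y + q * y ^+ 2) =
  (p * x + w * y) ^+ 2 + (p * q - w ^+ 2) * y ^+ 2 by ring.
have [y0|y0] := eqVneq y 0.
  move: xy; rewrite y0 eqxx orbF => x0.
  rewrite (_ : _ + _ = (p * x) ^+ 2); last by ring.
  have px0 : p * x != 0 by apply: mulf_neq0 => //; rewrite gt_eqF.
  by rewrite exprn_even_gt0.
by rewrite ltr_wpDl ?sqr_ge0// mulr_gt0 ?exprn_even_gt0// subr_gt0.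
Qed.

Lemma Jdiag2_orthogonal : (Jdiag 2)^T *m Jdiag 2 = 1%:M :> 'M[R]_2.
Proof.
apply/matrixP => -[[|[|//]] ilt] [[|[|//]] jlt];
by rewrite !mxE !big_ord_recl big_ord0 !mxE /=; ring.
Qed.

Lemma Jdiag4_orthogonal : (Jdiag 4)^T *m Jdiag 4 = 1%:M :> 'M[R]_4.
Proof.
apply/matrixP => -[[|[|[|[|//]]]] ilt] [[|[|[|[|//]]]] jlt];
by rewrite !mxE !big_ord_recl big_ord0 !mxE /=; ring.
Qed.

(** Within each pair of coordinates [A - I] is [diag(a - 1, 1 - a)]; its zero trace is what makes
    its product with [J_2] symmetric. *)
Definition Adiag m (a : R) : 'M[R]_m :=
  diag_mx (\row_i (if odd i then 2 - a else a)).

Lemma Jdiag_Adiag2_sym a :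
  (Jdiag 2 *m (Adiag 2 a - 1%:M))^T = Jdiag 2 *m (Adiag 2 a - 1%:M).
Proof.
apply/matrixP => -[[|[|//]] ilt] [[|[|//]] jlt];
by rewrite !mxE !big_ord_recl !big_ord0 !mxE /=; ring.
Qed.

Lemma Jdiag_Adiag4_sym a :
  (Jdiag 4 *m (Adiag 4 a - 1%:M))^T = Jdiag 4 *m (Adiag 4 a - 1%:M).
Proof.
apply/matrixP => -[[|[|[|[|//]]]] ilt] [[|[|[|[|//]]]] jlt];
by rewrite !mxE !big_ord_recl !big_ord0 !mxE /=; ring.
Qed.

(** All three forms required by [lyapunov_block] are diagonal here, so each contributes two sign
    conditions. *)
Lemma lyapunov_block2 (e s a u v : R) (U : 'M[R]_2) :
  (forall i j, U i j = nth 0 (nth [::] [:: [:: u; 0]; [:: 0; v]] i) j) ->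
  0 <= e < 1 ->
  s * a < 1 + u -> 2 * s ^+ 2 * a ^+ 2 < 1 + u + s * a ->
  2 * a ^+ 2 < 1 + u + s * a ->
  s * (2 - a) < 1 + v -> 2 * s ^+ 2 * (2 - a) ^+ 2 < 1 + v + s * (2 - a) ->
  2 * (2 - a) ^+ 2 < 1 + v + s * (2 - a) ->
  lyapunov (fun t => block_mx 1%:M (- Jdiag 2)
    (Jdiag 2) (1%:M - (1 + e * cos t)^-1 *: (1%:M + U))).
Proof.
move=> UE e01 hA hB hC kA kB kC.
apply: (@lyapunov_block R 2 e s U (Adiag 2 a)) => //.
- exact: Jdiag2_orthogonal.
- by rewrite tr_diag_mx.
- exact: Jdiag_Adiag2_sym.
move=> x x0; rewrite /dot !mxE !big_ord_recl !big_ord0 !mxE !big_ord_recl !big_ord0.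
rewrite !mxE !UE /=.
have nz : (x ord0 0 != 0) || (x (lift ord0 ord0) 0 != 0).
  apply: contraNT x0; rewrite negb_or !negbK => /andP[/eqP x1 /eqP x2].
  apply/eqP/matrixP => i j; rewrite ord1 mxE.
  by case: i => -[|[|//]] ilt; [rewrite -[RHS]x1|rewrite -[RHS]x2];
    congr (x _ _); exact: val_inj.
move: nz; move: (x ord0 0) (x (lift ord0 ord0) 0) => x1 x2 nz.
have pos p q : 0 < p -> 0 < q -> 0 < p * x1 ^+ 2 + 2 * 0 * x1 * x2 + q * x2 ^+ 2.
  by move=> p0 q0; apply: posdef2_gt0 => //; rewrite expr0n mulr_gt0.
rewrite -subr_gt0 in hA; rewrite -subr_gt0 in hB; rewrite -subr_gt0 in hC.
rewrite -subr_gt0 in kA; rewrite -subr_gt0 in kB; rewrite -subr_gt0 in kC.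
split; rewrite -subr_gt0.
- by move: (pos _ _ hA kA); congr (0 < _); ring.
- by move: (pos _ _ hB kB); congr (0 < _); ring.
- by move: (pos _ _ hC kC); congr (0 < _); ring.
Qed.

(** The coupling [w] joins coordinates 0 and 3, and [- w] joins 2 and 1. Each form thus splits into
    two binary forms with equal diagonals and determinants; the hypotheses are a positive leading
    entry and a positive determinant. *)
Lemma lyapunov_block4 (e s a u v w : R) (U : 'M[R]_4) :
  (forall i j, U i j = nth 0 (nth [::] [:: [:: u; 0; 0; w]; [:: 0; v; - w; 0];
                        [:: 0; - w; u; 0]; [:: w; 0; 0; v]] i) j) ->
  0 <= e < 1 ->
  let b := 2 - a in
  s * a < 1 + u -> w ^+ 2 < (1 + u - s * a) * (1 + v - s * b) ->
  2 * s ^+ 2 * a ^+ 2 < 1 + u + s * a ->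
  w ^+ 2 < (1 + u + s * a - 2 * s ^+ 2 * a ^+ 2) *
           (1 + v + s * b - 2 * s ^+ 2 * b ^+ 2) ->
  2 * a ^+ 2 < 1 + u + s * a ->
  w ^+ 2 < (1 + u + s * a - 2 * a ^+ 2) * (1 + v + s * b - 2 * b ^+ 2) ->
  lyapunov (fun t => block_mx 1%:M (- Jdiag 4)
    (Jdiag 4) (1%:M - (1 + e * cos t)^-1 *: (1%:M + U))).
Proof.
move=> UE e01 b hA kA hB kB hC kC.
apply: (@lyapunov_block R 4 e s U (Adiag 4 a)) => //.
- exact: Jdiag4_orthogonal.
- by rewrite tr_diag_mx.
- exact: Jdiag_Adiag4_sym.
move=> x x0; rewrite /dot !mxE !big_ord_recl !big_ord0 !mxE !big_ord_recl !big_ord0.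
rewrite !mxE !UE /=.
have nz : ((x ord0 0 != 0) || (x (lift ord0 (lift ord0 (lift ord0 ord0))) 0 != 0)) ||
    ((x (lift ord0 (lift ord0 ord0)) 0 != 0) || (x (lift ord0 ord0) 0 != 0)).
  apply: contraNT x0; rewrite !negb_or !negbK => /andP[/andP[/eqP x1 /eqP x4]].
  move=> /andP[/eqP x3 /eqP x2]; apply/eqP/matrixP => i j; rewrite ord1 mxE.
  by case: i => -[|[|[|[|//]]]] ilt;
    [rewrite -[RHS]x1|rewrite -[RHS]x2|rewrite -[RHS]x3|rewrite -[RHS]x4];
    congr (x _ _); exact: val_inj.
move: nz; move: (x ord0 0) (x (lift ord0 ord0) 0) (x (lift ord0 (lift ord0 ord0)) 0)
  (x (lift ord0 (lift ord0 (lift ord0 ord0))) 0) => x1 x2 x3 x4 nz.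
have pos p q : 0 < p -> w ^+ 2 < p * q ->
    0 < (p * x1 ^+ 2 + 2 * w * x1 * x4 + q * x4 ^+ 2) +
        (p * x3 ^+ 2 + 2 * - w * x3 * x2 + q * x2 ^+ 2).
  move=> p0 wpq; have wpq' : (- w) ^+ 2 < p * q by rewrite sqrrN.
  case/orP: nz => nz.
    by rewrite ltr_pwDl//; [exact: posdef2_gt0|exact: posdef2_ge0].
  by rewrite ltr_wpDl//; [exact: posdef2_ge0|exact: posdef2_gt0].
rewrite -subr_gt0 in hA; rewrite -subr_gt0 in hB; rewrite -subr_gt0 in hC.
split; rewrite -subr_gt0.
- by move: (pos _ _ hA kA); congr (0 < _); rewrite /b; ring.
- by move: (pos _ _ hB kB); congr (0 < _); rewrite /b; ring.
- by move: (pos _ _ hC kC); congr (0 < _); rewrite /b; ring.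
Qed.

End Blocks.

(** * Coefficients of the polygons and choice of the parameters *)

Section Coefficients.
Context {R : realType}.

Lemma sin_piB (x : R) : sin (pi - x) = sin x.
Proof. by rewrite sinB sinpi cospi mul0r mulN1r opprK add0r. Qed.

Lemma sin_polygon_gt0 n j : (0 < j < n)%N -> 0 < sin (pi * j%:R / n%:R) :> R.
Proof.
move=> /andP[j0 jn]; have n0 : (0 < n%:R :> R) by rewrite ltr0n (leq_trans _ jn).
have p0 : 0 < pi :> R by exact: pi_gt0.
apply: sin_gt0_pi; apply/andP; split.
  by rewrite divr_gt0// mulr_gt0// ltr0n.
by rewrite ltr_pdivrMr// ltr_pM2l// ltr_nat.
Qed.

Lemma lam_gt0 n : (1 < n)%N -> 0 < lam n :> R.
Proof.
move=> n1; rewrite /lam mulr_gt0 ?invr_gt0// big_ltn// ltr_pwDl//.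
  by rewrite invr_gt0 sin_polygon_gt0.
rewrite big_nat sumr_ge0// => j /andP[j1 jn].
by rewrite invr_ge0 ltW// sin_polygon_gt0// (ltnW j1).
Qed.

(** Each numerator is [2 sin^2], and the term [j = 1] is nonzero because [2 pi / n < pi] for
    [n > 2]. *)
Lemma zcoef_gt0 n : (2 < n)%N -> 0 < zcoef n :> R.
Proof.
move=> n2; rewrite /zcoef.
have E (x : R) : 1 - cos (2 * x) = 2 * sin x ^+ 2.
  by rewrite mulr_natl cos_mulr2n sin2cos2; ring.
have dist_gt0 j : (0 < j < n)%N -> 0 < 2 * dist n j ^+ 3 :> R.
  by move=> jn; rewrite mulr_gt0// exprn_gt0// mulr_gt0// sin_polygon_gt0.
rewrite big_ltn ?(ltnW n2)// ltr_pwDl//.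
  rewrite divr_gt0 ?dist_gt0 ?(ltnW n2)// E mulr_gt0// exprn_gt0//.
  rewrite /ang mulr1 [2 * pi]mulrC; have := @sin_polygon_gt0 n 2; rewrite n2.
  by apply.
rewrite big_nat sumr_ge0// => j /andP[j1 jn].
have dj : 0 < 2 * dist n j ^+ 3 :> R by rewrite dist_gt0// (ltnW j1).
by rewrite divr_ge0 ?(ltW dj)// E mulr_ge0 ?sqr_ge0.
Qed.

Lemma lyapunov_Bblock1 n (e : R) : (2 < n)%N -> 0 <= e < 1 -> lyapunov (Bblock n e 1).
Proof.
move=> n2 e01; have u0 : 0 < zcoef n / lam n :> R.
  by rewrite divr_gt0 ?zcoef_gt0 ?lam_gt0 ?(ltnW n2).
(* With [s = a = 1] all six conditions reduce to [0 < zcoef n / lam n]. *)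
apply: (@lyapunov_block2 R e 1 1 (zcoef n / lam n) (zcoef n / lam n) (U_first n)) => //;
  try lra.
by move=> [[|[|//]] ilt] [[|[|//]] jlt]; rewrite !mxE.
Qed.

Lemma lyapunov_Bblock42 (e : R) : 0 <= e < 1 -> lyapunov (Bblock 4 e 2).
Proof.
move=> e01.
set h : R := sin (pi / 4).
have h0 : 0 < h by have := @sin_polygon_gt0 4 1 isT; rewrite mulr1.
have c0 : cos (pi / 2) = 0 :> R by exact: cos_pihalf.
have h2 : h ^+ 2 = 2^-1.
  have := cos_mulr2n (pi / 4 : R); rewrite (_ : (pi / 4) *+ 2 = pi / 2); last by field.
  by rewrite c0 cos2sin2 -/h; lra.
have sin1 : sin (pi * 1%:R / 4%:R) = h by rewrite mulr1.
have sin2 : sin (pi * 2%:R / 4%:R) = 1 :> R.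
  by rewrite (_ : pi * 2%:R / 4%:R = pi / 2) ?sin_pihalf//; field.
have sin3 : sin (pi * 3%:R / 4%:R) = h.
  by rewrite (_ : pi * 3%:R / 4%:R = pi - pi / 4) ?sin_piB//; field.
have cos1 : cos (ang 4 1) = 0 :> R.
  by rewrite /ang (_ : 2 * pi * 1%:R / 4%:R = pi / 2) ?cos_pihalf//; field.
have cos2 : cos (ang 4 2) = -1 :> R.
  by rewrite /ang (_ : 2 * pi * 2%:R / 4%:R = pi) ?cospi//; field.
have cos3 : cos (ang 4 3) = 0 :> R.
  rewrite /ang (_ : 2 * pi * 3%:R / 4%:R = pi / 2 + pi); last by field.
  by rewrite cosDpi cos_pihalf oppr0.
have cos4 : cos (ang 4 4) = 1 :> R.
  by rewrite /ang (_ : 2 * pi * 4%:R / 4%:R = pi *+ 2) ?cos2pi//; field.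
have cos6 : cos (ang 4 6) = -1 :> R.
  by rewrite /ang (_ : 2 * pi * 6%:R / 4%:R = pi + pi *+ 2) ?cosD2pi ?cospi//; field.
(* From here on [h] is an abstract positive real with [h ^+ 2 = 1/2]. *)
move: h h0 h2 sin1 sin3 => h h0 h2 sin1 sin3.
have hV : h^-1 = 2 * h.
  by apply: (mulfI (lt0r_neq0 h0)); rewrite mulfV ?lt0r_neq0// mulrCA -expr2 h2 divff.
have hV3 : (2 * (2 * h) ^+ 3)^-1 = h / 4.
  rewrite (_ : 2 * (2 * h) ^+ 3 = 8 * h); last first.
    by transitivity (16 * h * h ^+ 2); [ring|rewrite h2; field].
  by rewrite invfM hV; field.
have sum3 (F : nat -> R) : \sum_(1 <= j < 4) F j = F 1%N + F 2%N + F 3%N.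
  by rewrite 3?big_ltn// big_geq// addr0 addrA.
have lamE : lam 4 = h + 4^-1 :> R.
  by rewrite /lam sum3 sin1 sin2 sin3 hV invr1; field.
have PE : Pcoef 4 2 = lam 4 / 2 :> R.
  rewrite /Pcoef /dist sum3 ?mul1n [(2 * 2)%N]/= [(3 * 2)%N]/=.
  by rewrite sin1 sin2 sin3 cos1 cos2 cos3 cos4 cos6 hV3 ?lamE; field.
have QE : Qcoef 4 2 = h / 2 - 8^-1 :> R.
  rewrite /Qcoef /dist sum3 ?mul1n.
  by rewrite sin1 sin2 sin3 cos1 cos2 cos3 cos4 cos6 hV3 ?lamE; field.
(* These two bounds on [h] translate into [w < 3/4] and [3/8 < w] below. *)
have hlt : h < 3 / 4 by nra.
have hgt : 5 / 12 < h by nra.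
have lam0 : 0 < lam 4 :> R by rewrite lam_gt0.
pose w : R := 3 * Qcoef 4 2 / lam 4.
have uE : (lam 4)^-1 * acoef 4 2 = 2^-1 - w.
  by rewrite /w /acoef PE; field; rewrite gt_eqF.
have vE : (lam 4)^-1 * bcoef 4 2 = 2^-1 + w.
  by rewrite /w /bcoef PE; field; rewrite gt_eqF.
have w1 : w < 3 / 4 by rewrite /w ltr_pdivrMr// QE lamE; lra.
have w2 : 3 / 8 < w by rewrite /w ltr_pdivlMr// QE lamE; lra.
(* As [U_2 = diag(1/2 - w, 1/2 + w)], the choice [s = 1], [a = 3/4] turns the six conditions into
   [3/8 < w < 3/4]. *)
apply: (@lyapunov_block2 R e 1 (3 / 4) ((lam 4)^-1 * acoef 4 2) ((lam 4)^-1 * bcoef 4 2)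
  (U_half 4 2)) => //; rewrite ?uE ?vE ?mul1r ?expr1n; try lra.
by move=> [[|[|//]] ilt] [[|[|//]] jlt]; rewrite !mxE /= ?mulr0.
Qed.

(** With [c = cos(2 pi / 5)], all sums, [lam 5] included, are [1 / sin(pi / 5)] times a rational
    polynomial in [c]; the common factor cancels in the quotients, and the quadratic relation for
    [c] reduces them to degree one. *)
Lemma pentagon_coefficients : exists c : R,
  [/\ 0 < c, 4 * c ^+ 2 + 2 * c = 1, acoef 5 2 = lam 5 * (5 * c - 2),
      bcoef 5 2 = lam 5 * (4 - 7 * c) & Scoef 5 2 = lam 5 * (2^-1 - c)].
Proof.
set c : R := cos (ang 5 1); set s1 : R := sin (pi * 1%:R / 5%:R).
have s1_gt0 : 0 < s1 by rewrite sin_polygon_gt0.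
have cE : c = 1 - 2 * s1 ^+ 2.
  rewrite /c (_ : ang 5 1 = (pi * 1%:R / 5%:R) *+ 2); last by rewrite /ang; field.
  by rewrite cos_mulr2n cos2sin2 -/s1; ring.
have sin2 : 0 < sin (pi * 2%:R / 5%:R) :> R by rewrite sin_polygon_gt0.
have sin3 : sin (pi * 3%:R / 5%:R) = sin (pi * 2%:R / 5%:R) :> R.
  by rewrite -[RHS]sin_piB; congr sin; field.
have sin4 : sin (pi * 4%:R / 5%:R) = s1.
  by rewrite -[RHS]sin_piB; congr sin; field.
have ang2 : ang 5 2 = ang 5 1 *+ 2 :> R by rewrite /ang; field.
have ang3 : ang 5 3 = ang 5 1 + ang 5 2 :> R by rewrite /ang; field.
have ang3' : ang 5 3 = - ang 5 2 + pi *+ 2 :> R by rewrite /ang; field.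
have ang4' : ang 5 4 = - ang 5 1 + pi *+ 2 :> R by rewrite /ang; field.
have ang6 : ang 5 6 = ang 5 1 + pi *+ 2 :> R by rewrite /ang; field.
have ang8 : ang 5 8 = - ang 5 2 + pi *+ 2 + pi *+ 2 :> R by rewrite /ang; field.
have cos2 : cos (ang 5 2) = 2 * c ^+ 2 - 1 by rewrite ang2 cos_mulr2n -/c; ring.
have cos3 : cos (ang 5 3) = 2 * c ^+ 2 - 1 by rewrite ang3' cosD2pi cosN.
have cos4 : cos (ang 5 4) = c by rewrite ang4' cosD2pi cosN.
have cos6 : cos (ang 5 6) = c by rewrite ang6 cosD2pi.
have cos8 : cos (ang 5 8) = 2 * c ^+ 2 - 1 by rewrite ang8 !cosD2pi cosN.
set t1 : R := sin (ang 5 1).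
have t1E : t1 ^+ 2 = 1 - c ^+ 2 by rewrite sin2cos2.
have tin2 : sin (ang 5 2) = 2 * c * t1 by rewrite ang2 sin_mulr2n -/c -/t1; ring.
have tin3 : sin (ang 5 3) = - (2 * c * t1) by rewrite ang3' sinD2pi sinN tin2.
have tin4 : sin (ang 5 4) = - t1 by rewrite ang4' sinD2pi sinN.
have tin6 : sin (ang 5 6) = t1 by rewrite ang6 sinD2pi.
have tin8 : sin (ang 5 8) = - (2 * c * t1) by rewrite ang8 !sinD2pi sinN tin2.
have s2E : sin (pi * 2%:R / 5%:R) ^+ 2 = 1 - c ^+ 2.
  by rewrite -t1E /t1; congr (sin _ ^+ 2); rewrite /ang; field.
have c0 : 0 < c.
  by apply: cos_gt0_pihalf; rewrite /ang; have := @pi_gt0 R => p0; apply/andP; split; lra.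
(* Two evaluations of [cos(6 pi / 5)] are compared: by reflection it is [cos(4 pi / 5)], and by
   addition it is a cubic in [c]. The factor [c - 1] is discarded later by [c < 1]. *)
have rel0 : (c - 1) * (4 * c ^+ 2 + 2 * c - 1) = 0.
  have : cos (ang 5 3) = c * (2 * c ^+ 2 - 1) - t1 * (2 * c * t1).
    by rewrite {1}ang3 cosD cos2 tin2.
  rewrite cos3 (_ : t1 * (2 * c * t1) = 2 * c * t1 ^+ 2); last by ring.
  by rewrite t1E => E; lra.
set s2 : R := sin (pi * 2%:R / 5%:R) in sin2 sin3 s2E.
have sin1 : sin (pi * 1%:R / 5%:R) = s1 by [].
have cos1 : cos (ang 5 1) = c by [].
have tin1 : sin (ang 5 1) = t1 by [].
have sin2' : sin (pi * 2%:R / 5%:R) = s2 by [].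
(* The trigonometric values become abstract reals; only algebraic relations are kept. *)
clear ang2 ang3 ang3' ang4' ang6 ang8.
move: c s1 t1 s2 cE s1_gt0 sin2 sin1 sin2' sin3 sin4 cos1 cos2 cos3 cos4 cos6 cos8
  tin1 t1E tin2 tin3 tin4 tin6 tin8 s2E c0 rel0.
move=> c s1 t1 s2 cE s1_gt0 s2_gt0 sin1 sin2 sin3 sin4 cos1 cos2 cos3 cos4 cos6 cos8.
move=> tin1 t1E tin2 tin3 tin4 tin6 tin8 s2E c0 rel0.
have c1 : c < 1 by rewrite cE; have := exprn_gt0 2 s1_gt0; lra.
have rel : 4 * c ^+ 2 + 2 * c = 1.
  by move/eqP: rel0; rewrite mulf_eq0 => /orP[]/eqP ?; lra.
have C2E : 2 * c ^+ 2 - 1 = - (c + 2^-1) by lra.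
have s2s1 : s2 = s1 * (2 * c + 1).
  apply/eqP; rewrite -(@eqrXn2 _ 2)// ?ltW// ?mulr_gt0//; last by lra.
  rewrite s2E exprMn (_ : s1 ^+ 2 = (1 - c) / 2); last by lra.
  (* Multiples of the relation for [c] are supplied by hand, since [lra] treats the powers of [c] as
     independent unknowns. *)
  apply/eqP; have : c * (4 * c ^+ 2 + 2 * c) = c * 1 by rewrite rel.
  by move=> rel3; lra.
pose v := s1^-1.
have s1v : s1 * v = 1 by rewrite mulfV// gt_eqF.
(* The relation says that [2 c] is the inverse of [2 c + 1]. *)
have s2V : s2^-1 = 2 * c * v.
  apply: mulr1_eq; rewrite s2s1.
  by transitivity (s1 * v * (4 * c ^+ 2 + 2 * c)); [ring|rewrite s1v rel mulr1].
(* The inverse of [1 - c] comes from [(1 - c) (2 c + 3) = 5/2]; for [d2V] it is combined with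
   [(2 c + 1)^-3 = 8 c^3 = 4 c - 1]. *)
have d1V : (2 * (2 * s1) ^+ 3)^-1 = v * (2 * c + 3) / 20.
  apply: mulr1_eq.
  transitivity (s1 * v * (16 * s1 ^+ 2 * (2 * c + 3) / 20)); first by field.
  by rewrite s1v (_ : s1 ^+ 2 = (1 - c) / 2); lra.
have d2V : (2 * (2 * s2) ^+ 3)^-1 = v * (6 * c - 1) / 20.
  apply: mulr1_eq; rewrite s2s1.
  transitivity (s1 * v * (16 * s1 ^+ 2 * (2 * c + 1) ^+ 3 * (6 * c - 1) / 20)).
    by field.
  rewrite s1v (_ : s1 ^+ 2 = (1 - c) / 2); last by lra.
  have rel3 : c * (4 * c ^+ 2 + 2 * c) = c * 1 by rewrite rel.
  have rel4 : c ^+ 2 * (4 * c ^+ 2 + 2 * c) = c ^+ 2 * 1 by rewrite rel.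
  have rel5 : c ^+ 3 * (4 * c ^+ 2 + 2 * c) = c ^+ 3 * 1 by rewrite rel.
  by lra.
have sum4 (F : nat -> R) : \sum_(1 <= j < 5) F j = F 1%N + F 2%N + F 3%N + F 4%N.
  by rewrite 4?big_ltn// big_geq// addr0 !addrA.
have lamE : lam 5 = v * (1 + 2 * c) / 2.
  by rewrite /lam sum4 sin1 sin2 sin3 sin4 s2V -/v; field.
have vrel : v * (4 * c ^+ 2 + 2 * c) = v * 1 by rewrite rel.
have vrel3 : v * c * (4 * c ^+ 2 + 2 * c) = v * c * 1 by rewrite rel.
(* This is the product of the cosines of [2 pi / 5] and [4 pi / 5]. *)
have cC : c * - (c + 2^-1) = - 4^-1 by lra.
have PE : Pcoef 5 2 = v * (4 * c + 1) / 4.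
  rewrite /Pcoef /dist sum4 ?mul1n sin1 sin2 sin3 sin4 cos1 cos2 cos3 cos4 cos6 cos8.
  by rewrite C2E d1V d2V !(mulrC (- (c + 2^-1)) c) cC; field.
have QE : Qcoef 5 2 = v * c.
  rewrite /Qcoef /dist sum4 ?mul1n sin1 sin2 sin3 sin4 cos1 cos2 cos3 cos4 cos6 cos8.
  by rewrite C2E d1V d2V; lra.
exists c; split=> //.
- by rewrite /acoef PE QE lamE; lra.
- by rewrite /bcoef PE QE lamE; lra.
(* This is the product of the sines of [2 pi / 5] and [4 pi / 5]. *)
have tt : 2 * c * t1 * t1 = c + 4^-1.
  have rel3 : c * (4 * c ^+ 2 + 2 * c) = c * 1 by rewrite rel.
  by rewrite -mulrA -expr2 t1E; lra.
rewrite /Scoef /dist sum4 ?mul1n sin1 sin2 sin3 sin4 tin1 tin2 tin3 tin4 tin6 tin8.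
rewrite d1V d2V lamE.
rewrite (_ : - t1 * (2 * c * t1) = - (2 * c * t1 * t1)); last by ring.
rewrite (_ : t1 * - (2 * c * t1) = - (2 * c * t1 * t1)); last by ring.
rewrite (_ : - (2 * c * t1) * - t1 = 2 * c * t1 * t1); last by ring.
by rewrite tt; lra.
Qed.

Lemma lyapunov_Bblock52 (e : R) : 0 <= e < 1 -> lyapunov (Bblock 5 e 2).
Proof.
move=> e01; have [c [c0 rel aE bE SE]] := pentagon_coefficients.
have lam0 : lam 5 != 0 :> R by rewrite gt_eqF// lam_gt0.
have c1 : 309 / 1000 < c by nra.
have c2 : c < 3091 / 10000 by nra.
(* The bounds on [c] fix the entries up to [10^-3]: -0.455 and 1.837 on the diagonal, 0.191 off it.
   For these [s] and [a] the three products of diagonal entries are about 0.068, 0.90 and 0.051,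
   against a squared coupling of about 0.036. *)
apply: (@lyapunov_block4 R e (39 / 50) (13 / 20) (5 * c - 2) (4 - 7 * c) (2^-1 - c)
  (U_middle 5 2)) => //; try lra; try nra.
by move=> [[|[|[|[|//]]]] ilt] [[|[|[|[|//]]]] jlt];
  rewrite !mxE /= ?mulr0 ?mulrN ?aE ?bE ?SE ?mulKf.
Qed.

End Coefficients.

Theorem corollary1p6 (R : realType) (n : nat) (e : R) :
  n \in [:: 3; 4; 5]%N -> 0 <= e < 1 -> ERE_hyperbolic n e.
Proof.
move=> n345 e01; suff Blyap : lyapunov (B_ess n e).
  by move=> eta; exact: lyapunov_hyperbolic.
move: n345; rewrite !inE => /or3P[] /eqP->.
(* [n./2.-1] is 0 for [n = 3] and 1 for [n = 4, 5], so [B_ess] computes to one block or to a sum of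
   two. *)
- exact: lyapunov_Bblock1.
- by apply: lyapunov_diamond; [exact: lyapunov_Bblock1|exact: lyapunov_Bblock42].
- by apply: lyapunov_diamond; [exact: lyapunov_Bblock1|exact: lyapunov_Bblock52].
Qed.
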